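(* Let $G=(V,E,\sigma,o)$ be a radially symmetric tree, fix constants $0<\alpha_1\le\alpha_2$, and let $\Sigma=\{\sigma\in\mathbb{R}^E_{>0}:\alpha_1\le\sigma\le\alpha_2\}$. Suppose $\mathrm{Mod}_{p,1}(\Gamma_\infty)>0$ for some $1<p<\infty$. Then the function $F:\Sigma\to\mathbb{R}$, $F(\sigma)=\mathrm{Mod}_{p,\sigma}(\Gamma_\infty)$, is Lipschitz continuous on $\Sigma$ with respect to the $\infty$-norm $\|\sigma\|_\infty=\sup_{e\in E}|\sigma(e)|$.
   Context: A rooted tree $G$ has root $o$ and edge set $E$; a weight is $\sigma:E\to\mathbb{R}_{>0}$. The generation of an edge is the number of edges on the unique path from $o$ ending with it; $e$ is the parent of $e'$ if they are adjacent and $e'$ has generation one more. A proper infinite tree is infinite, locally finite, and every edge has at least one child; it is radially symmetric if the number of children of an edge depends only on its generation. A descending path is a path $e_1e_2\cdots$ from $o$ with $e_i$ the parent of $e_{i+1}$; $\Gamma_\infty$ is the set of infinite descending paths. For $\rho:E\to[0,\infty)$, $\ell_\rho(\gamma)=\sum_{e\in\gamma}\rho(e)$; $\mathrm{Adm}(\Gamma_\infty)$ consists of $\rho\ge0$ with $\ell_\rho(\gamma)\ge1$ for all $\gamma\in\Gamma_\infty$. $\mathcal{E}_{p,\sigma}(\rho)=\sum_e\sigma(e)\rho(e)^p$, $\mathrm{Mod}_{p,\sigma}(\Gamma_\infty)=\inf_{\rho\in\mathrm{Adm}(\Gamma_\infty)}\mathcal{E}_{p,\sigma}(\rho)$, and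 $\mathrm{Mod}_{p,1}$ denotes the case $\sigma\equiv1$. *)

(* Defs.v *)
From HB Require Import structures.
From mathcomp Require Import all_boot all_order all_algebra.
From mathcomp Require Import all_classical all_reals all_analysis.

Set Implicit Arguments.
Unset Strict Implicit.
Unset Printing Implicit Defensive.

Import Order.TTheory GRing.Theory Num.Theory.

Local Open Scope classical_set_scope.
Local Open Scope ring_scope.

(* A walk from x is a sequence x :: s with path adj x s; an acyclic graph has
   no closed walk through three or more distinct vertices. *)
Record rooted_tree := RootedTree {
  vertex :> choiceType;
  adj : rel vertex;
  root : vertex;
  adj_sym : symmetric adj;
  adj_irr : irreflexive adj;
  tree_connected : forall x y, exists s, path adj x s /\ last x s = y;
  tree_acyclic : forall c, ucycle adj c -> (size c <= 2)%N }.

Section Tree.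
Variable G : rooted_tree.

Definition edges : set (set G) :=
  [set e | exists x y, adj x y /\ e = [set x; y]].

Definition edge : choiceType := set_type edges.

(* The path is written root :: rcons s y, so that it has (size s).+1 edges and
   its last edge joins last (root G) s to y. In a tree the set below is a
   singleton; xget is definite description with default 0. *)
Definition generation (e : edge) : nat :=
  xget 0%N [set n | exists s y,
    [/\ path (@adj G) (root G) (rcons s y), uniq (root G :: rcons s y),
        val e = [set last (root G) s; y] & n = (size s).+1]].

Definition adjacent (e e' : edge) : Prop :=
  e <> e' /\ val e `&` val e' !=set0.

Definition parent (e e' : edge) : Prop :=
  adjacent e e' /\ generation e' = (generation e).+1.

Definition children (e : edge) : set edge := [set e' | parent e e'].

Definition locally_finite_tree : Prop :=
  forall x : G, finite_set [set y | adj x y].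

Definition proper_infinite : Prop :=
  [/\ infinite_set [set: G], locally_finite_tree
    & forall e : edge, children e !=set0].

Definition radially_symmetric : Prop :=
  proper_infinite /\
  forall e e' : edge, generation e = generation e' -> (children e #= children e')%card.

(* g i is the (i+1)-st edge of the path; v lists its vertices from the root. *)
Definition descending_path (g : nat -> edge) : Prop :=
  exists v : nat -> G,
    [/\ v 0%N = root G, injective v,
        forall i, val (g i) = [set v i; v i.+1]
      & forall i, parent (g i) (g i.+1)].

Definition Gamma_infty : set (nat -> edge) := [set g | descending_path g].

Section Modulus.
Variable R : realType.
Implicit Types (sigma rho : edge -> R) (p : R).

Definition rho_length rho (g : nat -> edge) : \bar R :=
  \esum_(e in range g) (rho e)%:E.

Definition Adm : set (edge -> R) :=
  [set rho | (forall e, 0 <= rho e) /\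
             forall g, Gamma_infty g -> (1 <= rho_length rho g)%E].

Definition energy p sigma rho : \bar R :=
  \esum_(e in [set: edge]) (sigma e * rho e `^ p)%:E.

Definition Mod p sigma : \bar R := ereal_inf [set energy p sigma rho | rho in Adm].

Definition Sigma (alpha1 alpha2 : R) : set (edge -> R) :=
  [set sigma | forall e, 0 < sigma e /\ alpha1 <= sigma e <= alpha2].

Definition infty_norm sigma : \bar R :=
  ereal_sup [set `|sigma e|%:E | e in [set: edge]].

Definition lipschitz_infty (A : set (edge -> R)) (F : (edge -> R) -> R) : Prop :=
  exists L : R, 0 <= L /\
    forall s t, A s -> A t ->
      (`|F s - F t|%:E <= L%:E * infty_norm (s \- t)%R)%E.

End Modulus.
End Tree.

(* Main.v *)
Require Import Defs.
From HB Require Import structures.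
From mathcomp Require Import all_boot all_order all_algebra.
From mathcomp Require Import all_classical all_reals all_analysis.
From mathcomp Require Import ring lra.

(** Scaling: if [s <= c * t] pointwise then [Mod p s <= c * Mod p t].  Since
    [t >= alpha1], one has [s <= (1 + |s - t| / alpha1) * t], whence
    [Mod p s - Mod p t <= |s - t| / alpha1 * Mod p t], and [Mod p t] is at most
    [alpha2 * Mod p 1].  The latter is finite because the indicator of the
    finitely many edges at the root is admissible. *)

Set Implicit Arguments.
Unset Strict Implicit.
Unset Printing Implicit Defensive.

Import Order.TTheory GRing.Theory Num.Theory.

Local Open Scope classical_set_scope.
Local Open Scope ring_scope.

Section Modulus.
Variables (R : realType) (G : rooted_tree).
Implicit Types (s t rho : edge G -> R) (p c : R).

Lemma energy_ge0 p s rho : (forall e, 0 <= s e) -> (0 <= energy p s rho)%E.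
Proof.
by move=> s0; apply: esum_ge0 => e _; rewrite lee_fin mulr_ge0 ?powR_ge0.
Qed.

Lemma Mod_ge0 p s : (forall e, 0 <= s e) -> (0 <= Mod p s)%E.
Proof.
by move=> s0; apply: le_ereal_inf_tmp => _ [rho _ <-]; exact: energy_ge0.
Qed.

(** The energy is a supremum of finite sums, so the termwise bound is only needed on each finite set
    [A] of edges. *)
Lemma energy_le_scale p c s t rho : 0 <= c -> (forall e, 0 <= t e) ->
  (forall e, s e <= c * t e) ->
  (energy p s rho <= c%:E * energy p t rho)%E.
Proof.
move=> c0 t0 st; apply: ge_ereal_sup => _ [A [finA _] <-].
have tp0 e : (0 <= (t e * rho e `^ p)%:E)%E.
  by rewrite lee_fin mulr_ge0 ?powR_ge0.
apply: (@le_trans _ _ (c%:E * \sum_(e \in A) (t e * rho e `^ p)%:E)%E).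
  rewrite ge0_mule_fsumr//; apply: lee_fsum => // e _.
  by rewrite -EFinM lee_fin mulrA ler_wpM2r ?powR_ge0.
by apply: lee_wpmul2l => //; apply: esum_ge; exists A.
Qed.

(** Admissibility does not depend on the weight, so the same [rho] competes in both infima. Dividing
    by [c > 0] leaves a lower bound for [Mod p t], checked one [rho] at a time. *)
Lemma Mod_le_scale p c s t : 0 < c -> (forall e, 0 <= t e) ->
  (forall e, s e <= c * t e) -> (Mod p s <= c%:E * Mod p t)%E.
Proof.
move=> c0 t0 st; rewrite -lee_pdivrMl//.
apply: le_ereal_inf_tmp => _ [rho Arho <-]; rewrite lee_pdivrMl//.
apply: le_trans (energy_le_scale p rho (ltW c0) t0 st).
by apply: ereal_inf_lbound; exists rho.
Qed.

Let root_edges : set (edge G) := [set e | val e (Defs.root G)].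

(** An edge at the root is determined by its other endpoint, one of the finitely many neighbours of
    the root. *)
Lemma finite_root_edges : locally_finite_tree G -> finite_set root_edges.
Proof.
move=> lf.
pose star := [set [set Defs.root G; y] | y in [set y | adj (Defs.root G) y]].
have finV : finite_set ((fun e : edge G => val e) @^-1` star).
  apply: finite_preimage; last exact/finite_image/lf.
  by move=> e e' _ _; exact: val_inj.
apply: sub_finite_set finV => e; rewrite /root_edges/=.
have [x [y [+ ->]]] : edges (val e) := set_valP e.
move=> /[swap] -[<-|<-] xy; first by exists y.
by exists x; [rewrite /= adj_sym | rewrite setUC].
Qed.

(** A descending path starts at the root, so its first edge alone contributes length 1. *)
Lemma Adm_root_edges : Adm (\1_root_edges : edge G -> R).
Proof.
split=> [e|g [v [v0 _ gv _]]]; first by rewrite indicE ler0n.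
apply: esum_ge; exists [set g 0%N].
  by split; [exact: finite_set1 | move=> _ ->; exists 0%N].
rewrite fsbig_set1 indicE mem_set// /root_edges/= gv v0.
by left.
Qed.

Lemma Mod1_lty p : locally_finite_tree G -> p != 0 ->
  (Mod p (fun _ : edge G => 1%R : R) < +oo)%E.
Proof.
move=> lf p0.
apply: (@le_lt_trans _ _ (energy p (fun=> 1 : R) (\1_root_edges))).
  by apply: ereal_inf_lbound; eexists; [exact: Adm_root_edges|].
have finE := finite_root_edges lf.
rewrite /energy (_ : esum _ _ = \esum_(e in root_edges) 1%:E); last first.
  rewrite [RHS]esum_mkcond; apply: eq_esum => e _; rewrite indicE mul1r.
  by case: ifP => _; rewrite ?powR1 ?powR0.
by rewrite esum_fset// fsbig_finite// sumEFin ltry.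
Qed.

Lemma infty_norm_lbound s e : (`|s e|%:E <= infty_norm s)%E.
Proof. by apply: ereal_sup_ubound; exists e. Qed.

End Modulus.

Section SigmaBounds.
Variables (R : realType) (G : rooted_tree) (alpha1 alpha2 p : R).
Hypotheses (lfG : locally_finite_tree G) (p_neq0 : p != 0).
Hypotheses (alpha1_gt0 : 0 < alpha1) (alpha12 : alpha1 <= alpha2).
Implicit Types s t : edge G -> R.

Let alpha2_gt0 : 0 < alpha2. Proof. exact: lt_le_trans alpha12. Qed.

Let Mod1 : \bar R := Mod p (fun _ : edge G => 1).

Let Mod1_fin : Mod1 \is a fin_num.
Proof. by rewrite ge0_fin_numE ?Mod1_lty// Mod_ge0. Qed.

Lemma Mod_Sigma_le s : Sigma alpha1 alpha2 s -> (Mod p s <= alpha2%:E * Mod1)%E.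
Proof.
move=> As; apply: Mod_le_scale => // e.
by rewrite mulr1; have [_ /andP[]] := As e.
Qed.

Lemma Mod_Sigma_fin s : Sigma alpha1 alpha2 s -> Mod p s \is a fin_num.
Proof.
move=> As; rewrite ge0_fin_numE; last by apply: Mod_ge0 => e; case: (As e) => /ltW.
apply: le_lt_trans (Mod_Sigma_le As) _.
by rewrite -(fineK Mod1_fin) -EFinM ltry.
Qed.

(** One half of the Lipschitz bound, with a real [d] standing for the extended-real norm; the other
    half follows by exchanging [s] and [t]. *)
Lemma Mod_Sigma_sub_le s t (d : R) : 0 <= d ->
  Sigma alpha1 alpha2 s -> Sigma alpha1 alpha2 t ->
  (forall e, `|s e - t e| <= d) ->
  fine (Mod p s) - fine (Mod p t) <= alpha2 / alpha1 * fine Mod1 * d.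
Proof.
move=> d0 As At std.
have da0 : 0 <= d / alpha1 by rewrite divr_ge0// ltW.
have : (Mod p s <= (1 + d / alpha1)%:E * Mod p t)%E.
  apply: Mod_le_scale; first exact: ltr_wpDr.
    by move=> e; case: (At e) => /ltW.
  move=> e; have [_ /andP[a1t _]] := At e.
  (* Here [s e - t e <= d = (d / alpha1) * alpha1 <= (d / alpha1) * t e]. *)
  rewrite mulrDl mul1r -lerBlDl (le_trans (ler_norm _))// (le_trans (std e))//.
  by rewrite -mulrA ler_peMr// ler_pdivlMl// mulr1.
rewrite -(fineK (Mod_Sigma_fin As)) -(fineK (Mod_Sigma_fin At)) -EFinM lee_fin /=.
rewrite mulrDl mul1r -lerBlDl => /le_trans; apply.
have := Mod_Sigma_le At.
rewrite -(fineK (Mod_Sigma_fin At)) -(fineK Mod1_fin) -EFinM lee_fin => le2.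
apply: le_trans (ler_wpM2l da0 le2) _.
by rewrite le_eqVlt; apply/orP; left; apply/eqP; ring.
Qed.

Lemma Mod_lipschitz :
  lipschitz_infty (Sigma alpha1 alpha2) (fun s => fine (Mod p s)).
Proof.
(* Without edges the norm is a supremum over the empty set, hence [-oo]; the constant 0 is chosen
   because [0 * -oo = 0]. *)
have [[e0 _]|noE] := pselect (exists e : edge G, True); last first.
  exists 0; split => // s t _ _; have -> : s = t.
    by apply/funext => e; case: noE; exists e.
  by rewrite subrr normr0 mul0e.
exists (alpha2 / alpha1 * fine Mod1); split.
  by rewrite !mulr_ge0 ?invr_ge0 ?fine_ge0 ?Mod_ge0// ltW.
move=> s t As At.
have norm_ge0 : (0 <= infty_norm (s \- t)%R)%E.
  by apply: le_trans (infty_norm_lbound _ e0); rewrite lee_fin.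
have norm_fin : infty_norm (s \- t) \is a fin_num.
  rewrite ge0_fin_numE//; apply: (@le_lt_trans _ _ alpha2%:E); last exact: ltry.
  apply: ge_ereal_sup => _ [e _ <-]; rewrite lee_fin ler_norml.
  (* Both weights lie between 0 and [alpha2], so they differ by at most [alpha2]. *)
  have [? /andP[_ ?]] := As e; have [? /andP[_ ?]] := At e.
  by apply/andP; split; rewrite /=; lra.
have std e : `|s e - t e| <= fine (infty_norm (s \- t)).
  by rewrite -lee_fin fineK//; exact: (infty_norm_lbound (s \- t)).
have d0 : 0 <= fine (infty_norm (s \- t)) by exact: fine_ge0.
rewrite -(fineK norm_fin) -EFinM lee_fin ler_norml lerNl opprB.
by rewrite !Mod_Sigma_sub_le// => e; rewrite distrC.
Qed.

End SigmaBounds.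

(** Finiteness is asserted as well because [fine] sends infinite values to 0; it makes
    [fine (Mod p sigma)] the true modulus. *)
Theorem theorem12 (R : realType) (G : rooted_tree) (alpha1 alpha2 p : R) :
  radially_symmetric G ->
  0 < alpha1 -> alpha1 <= alpha2 ->
  1 < p ->
  (0 < Mod p (fun _ : edge G => 1%R))%E ->
  (forall sigma : edge G -> R,
      Sigma alpha1 alpha2 sigma -> Mod p sigma \is a fin_num) /\
  lipschitz_infty (Sigma alpha1 alpha2)
    (fun sigma : edge G -> R => fine (Mod p sigma)).
Proof.
move=> [[_ lfG _] _] a1 a12 p1 _.
have p0 : p != 0 by rewrite gt_eqF// (lt_trans _ p1).
by split=> [s As|]; [exact: (Mod_Sigma_fin lfG p0 a1 a12 As) | exact: Mod_lipschitz].
Qed.
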